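(* Let $\lambda$ be a landscape sequence. There exists a finite multiset of tent functions $\{f_{(b_i,d_i)}\}$ such that $$\lambda=\bigoplus_i f_{(b_i,d_i)},$$ where each summand $f_{(b_i,d_i)}$ appears with multiplicity $$\deg_\lambda\left(\frac{b_i+d_i}{2},\frac{d_i-b_i}{2}\right)>0.$$ Moreover, this decomposition is unique up to the ordering of the summands.
   Context: A landscape curve is a function $\mathbb{R}\to\mathbb{R}$ that is non-negative, continuous, piecewise-linear, compactly supported, differentiable except at finitely many points (its critical points), and whose derivative at each non-critical point of its support is $+1$ or $-1$. (Hence each critical point is a local maximum or a local minimum, exclusively.) A pair $(t,h)$ is called a local max. (min.) of a curve if the curve has value $h$ at $t$ and $t$ is a critical point which is a local maximum (minimum) of the curve. A landscape sequence is a sequence $\lambda=(\lambda_1,\lambda_2,\dots)$ of functions $\mathbb{R}\to\mathbb{R}$ such that: each $\lambda_k$ is a landscape curve; $\lambda_k(t)\ge\lambda_{k+1}(t)$ for all $k\in\mathbb{N}=\{1,2,\dots\}$, $t\in\mathbb{R}$; there is $K\in\mathbb{N}$ with $\lambda_k=0$ for all $k\ge K$; and every $(t,h)\in\mathbb{R}^2$ with $h>0$ satisfies $\deg_\lambda(t,h)\ge0$, where $\deg_\lambda(t,h)=|\{k:(t,h)\text{ is a local max. of }\lambda_k\}|-|\{k:(t,h)\text{ is a local min. of }\lambda_k\}|$. For real $b<d$, the tent function $f_{(b,d)}:\mathbb{R}\to\mathbb{R}$ is $f_{(b,d)}(t)=\max\{0,\min\{t-b,\,d-t\}\}$; the same symbol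 also denotes the landscape sequence $(f_{(b,d)},0,0,\dots)$. The direct sum $\lambda=\eta\oplus\mu$ of landscape sequences $\eta,\mu$ is the sequence (again a landscape sequence) with $\lambda_k(t)=k\mathrm{max}\{\eta_1(t),\dots,\eta_k(t),\mu_1(t),\dots,\mu_k(t)\}$, where $k\mathrm{max}$ denotes the $k$-th largest element counted with multiplicity. Finite direct sums are obtained by iterating this operation; the empty direct sum is the zero sequence. *)

(* Defs.v *)
From HB Require Import structures.
From mathcomp Require Export all_boot all_order all_algebra.
From mathcomp Require Export finmap all_classical all_reals all_analysis.
Export Order.TTheory GRing.Theory Num.Theory.
Export numFieldNormedType.Exports.

Set Implicit Arguments.
Unset Strict Implicit.
Unset Printing Implicit Defensive.

Local Open Scope classical_set_scope.
Local Open Scope ring_scope.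

Section Landscapes.
Variable R : realType.

Definition piecewise_linear (f : R -> R) : Prop :=
  exists breaks : seq R, forall I : interval R,
    (forall c, c \in breaks -> c \notin I) ->
    exists a b : R, forall t, t \in I -> f t = a * t + b.

Definition closed_support (f : R -> R) : set R := closure [set t | f t != 0].

Definition critical_point (f : R -> R) (t : R) : Prop := ~ derivable f t 1.

Record landscape_curve (f : R -> R) : Prop := LandscapeCurve {
  landscape_curve_ge0 : forall t, 0 <= f t;
  landscape_curve_continuous : continuous f;
  landscape_curve_pl : piecewise_linear f;
  landscape_curve_compact : compact (closed_support f);
  landscape_curve_critical : finite_set [set t | critical_point f t];
  landscape_curve_slope : forall t, closed_support f t ->
    ~ critical_point f t -> derive1 f t = 1 \/ derive1 f t = -1
}.

Definition local_max (f : R -> R) (t h : R) : Prop :=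
  [/\ f t = h, critical_point f t & \forall s \near t, f s <= f t].

Definition local_min (f : R -> R) (t h : R) : Prop :=
  [/\ f t = h, critical_point f t & \forall s \near t, f t <= f s].

(* Sequences are indexed from 0, so [lam k] is the curve usually written
   lambda_{k+1}. *)
Implicit Types lam eta mu : nat -> R -> R.

(* [fset_set A] is the empty set when [A] is infinite.  If all but finitely
   many of the curves are zero, both index sets below are finite, since a
   constant function has no critical point. *)
Definition deg lam (t h : R) : int :=
  #|` fset_set [set k | local_max (lam k) t h]|%:Z
  - #|` fset_set [set k | local_min (lam k) t h]|%:Z.

Record landscape_sequence lam : Prop := LandscapeSequence {
  landscape_sequence_curve : forall k, landscape_curve (lam k);
  landscape_sequence_decr : forall k t, lam k.+1 t <= lam k t;
  landscape_sequence_finite :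
    exists K : nat, forall k, (K <= k)%N -> forall t, lam k t = 0;
  landscape_sequence_deg : forall t h : R, 0 < h -> 0 <= deg lam t h
}.

Definition tent (b d t : R) : R := Num.max 0 (Num.min (t - b) (d - t)).

Definition zero_sequence : nat -> R -> R := fun _ _ => 0.

Definition tent_sequence (p : R * R) : nat -> R -> R :=
  fun k => if k is 0%N then tent p.1 p.2 else fun _ => 0.

(* The largest element of [s] is [kmax 0 s]. *)
Definition kmax (k : nat) (s : seq R) : R := nth 0 (sort >=%R s) k.

Definition direct_sum eta mu : nat -> R -> R := fun k t =>
  kmax k ([seq eta j t | j <- iota 0 k.+1] ++ [seq mu j t | j <- iota 0 k.+1]).

(* A finite multiset of tent functions f_(b,d), b < d, is given by the pairs
   (b, d), up to [perm_eq]; distinct pairs with b < d give distinct tents. *)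
Definition tent_decomposition lam (s : seq (R * R)) : Prop :=
  (forall p, p \in s -> p.1 < p.2) /\
  lam = \big[direct_sum/zero_sequence]_(p <- s) tent_sequence p.

End Landscapes.

(* Main.v *)
Require Import Defs.
From mathcomp Require Import zify ring lra.

(** The proof passes through the rank function, which sends [(t, h)] with [0 < h] to
the number of indices [k] with [h <= lam k t].  A nonincreasing nonnegative sequence
of curves is determined by its rank function ([has_rank_eq]), and taking a direct sum
adds rank functions ([has_rank_direct_sum]).  The point [(t, h)] lies below the tent
on the base from [b] to [d] exactly when this base contains the window from [t - h] to
[t + h].  Hence a sequence is the direct sum of the tents of a multiset of intervals
if and only if its rank function counts the intervals containing each window.

Uniqueness follows: such counts determine a finite multiset of intervals, which is
seen by peeling off the longest interval ([rank_invariant_inj]).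

For existence, take each point of positive height and degree as the peak of a tent, with the
degree as multiplicity.  The required count is then a sum of degrees over a quadrant
of the half plane.  Exchanging summations ([deg_sum_contains]), it is enough to show
for a single curve that the local maxima minus the local minima in the quadrant number
[1] if the curve passes above the corner [(t, h)] and [0] otherwise
([peak_index_sum]).  A peak is half a drop of slope ([peak_indexE]), so a sum over
consecutive peaks telescopes; and as the slopes are [1] and [-1], the graph enters the
quadrant going up, leaves it going down, and meets it in one stretch, which leaves
[(1 - (-1)) / 2 = 1].  This is carried out with a quantity ([potential]) that is
constant along affine pieces and drops by the index, doubled, at each break inside the
quadrant. *)

Set Implicit Arguments.
Unset Strict Implicit.
Unset Printing Implicit Defensive.

Local Open Scope classical_set_scope.
Local Open Scope ring_scope.

(** * Rank functions and multisets of intervals *)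

Section Ranks.
Variable R : realType.
Implicit Types (eta mu : nat -> R -> R) (s : seq (R * R)).

(** This turns order statistics into counting; positivity of [h] matters because
[kmax] returns [0] beyond the end of the list. *)
Lemma le_kmax (h : R) (k : nat) (l : seq R) :
  0 < h -> (h <= kmax k l) = (k < count (>= h) l)%N.
Proof.
move=> h0; rewrite /kmax -(count_sort >=%R).
have: sorted >=%R (sort >=%R l) by apply: sort_sorted => x y; exact: le_total.
elim: (sort _ l) k => [|x s IH] k /=.
  by move=> _; rewrite nth_nil leNgt h0.
move=> xs; have s_sorted := path_sorted xs.
have s_le : all (<= x) s.
  by have := order_path_min _ xs; apply=> a b c /= ba cb; exact: le_trans cb ba.
have [hx|xh] := leP h x; first by case: k => [|k] //=; rewrite IH.
have s_lt : count (>= h) s = 0%N.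
  apply/eqP; rewrite -leqn0 leqNgt -has_count; apply/hasPn => y ys /=.
  by rewrite -ltNge (le_lt_trans _ xh) //; exact: (allP s_le).
case: k => [|k] /=; last by rewrite IH // s_lt.
by rewrite s_lt leNgt xh.
Qed.

(** [N t h] counts the indices [k] with [h <= eta k t]; since these form an initial
segment, the count tests membership of each single index.  Only positive heights
matter, so a rank function carries all information on a nonnegative sequence. *)
Definition has_rank eta (N : R -> R -> nat) :=
  forall k t, 0 <= eta k t /\ forall h, 0 < h -> (h <= eta k t) = (k < N t h)%N.

Lemma has_rank_eq eta mu N : has_rank eta N -> has_rank mu N -> eta = mu.
Proof.
move=> etaN muN; apply/funext => k; apply/funext => t.
have [eta0 etaE] := etaN k t; have [mu0 muE] := muN k t.
apply/eqP; rewrite eq_le; apply/andP; split.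
  have [|h0] := leP (eta k t) 0; first by move/le_trans; apply.
  by rewrite muE // -etaE.
have [|h0] := leP (mu k t) 0; first by move/le_trans; apply.
by rewrite etaE // -muE.
Qed.

Lemma has_rank_uniq eta N M t h : has_rank eta N -> has_rank eta M -> 0 < h ->
  N t h = M t h.
Proof.
move=> etaN etaM h0.
have rankE k : (k < N t h)%N = (k < M t h)%N.
  by have [_ <- //] := etaN k t; have [_ <-] := etaM k t.
case: (ltngtP (N t h) (M t h)) => //; first by rewrite -rankE ltnn.
by rewrite rankE ltnn.
Qed.

Lemma count_rank eta N k t h : has_rank eta N -> 0 < h ->
  count (>= h) [seq eta j t | j <- iota 0 k.+1] = minn k.+1 (N t h).
Proof.
move=> etaN h0; rewrite count_map.
rewrite (@eq_count _ _ (fun j => (j < N t h)%N)); last first.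
  by move=> j /=; have [_ ->] := etaN j t.
elim: k.+1 => [|n IH]; first by rewrite min0n.
by rewrite -addn1 iotaD count_cat IH /= add0n addn1; case: (ltnP n (N t h)); lia.
Qed.

Lemma kmax_ge0 k (l : seq R) : {in l, forall x, 0 <= x} -> 0 <= kmax k l.
Proof.
move=> l0; rewrite /kmax; have [kl|lk] := ltnP k (size (sort >=%R l)).
  by apply: l0; rewrite -(mem_sort >=%R) mem_nth.
by rewrite nth_default.
Qed.

(** Truncating both families to their first [k.+1] members loses nothing: for any
[a] and [b], [k < minn k.+1 a + minn k.+1 b] holds exactly when [k < a + b]. *)
Lemma has_rank_direct_sum eta mu N M : has_rank eta N -> has_rank mu M ->
  has_rank (direct_sum eta mu) (fun t h => N t h + M t h)%N.
Proof.
move=> etaN muM k t; split.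
  apply: kmax_ge0 => x; rewrite mem_cat => /orP[] /mapP[j _ ->].
    by have [] := etaN j t.
  by have [] := muM j t.
move=> h h0; rewrite /direct_sum le_kmax // count_cat.
by rewrite (count_rank _ _ etaN) // (count_rank _ _ muM) //; lia.
Qed.

(** Pairs stand for intervals, given by their end points. *)
Definition contains (X Y : R) (p : R * R) := (p.1 <= X) && (Y <= p.2).

(** The points below the graph of a tent are the windows inside its interval: this
makes the rank of a sum of tents a count of intervals. *)
Lemma le_tent (p : R * R) (t h : R) : 0 < h ->
  (h <= tent p.1 p.2 t) = contains (t - h) (t + h) p.
Proof.
move=> h0; rewrite /tent /contains le_max lt_geF //= le_min.
by congr (_ && _); apply/idP/idP => ?; lra.
Qed.

Lemma has_rank_tent (p : R * R) :
  has_rank (tent_sequence p) (fun t h => contains (t - h) (t + h) p : nat).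
Proof.
move=> [|k] t /=; split=> //.
- by rewrite /tent le_max lexx.
- by move=> h h0; rewrite le_tent //; case: contains.
- by move=> h h0; rewrite lt_geF //; case: contains.
Qed.

Lemma has_rank_tents s :
  has_rank (\big[@direct_sum R/@zero_sequence R]_(p <- s) tent_sequence p)
    (fun t h => count (contains (t - h) (t + h)) s).
Proof.
elim: s => [|p s IH]; last first.
  by rewrite big_cons; exact: has_rank_direct_sum (has_rank_tent p) IH.
rewrite big_nil => k t; split=> // h h0.
by rewrite /zero_sequence lt_geF.
Qed.

(** The window spanned by a longest interval [p] of both multisets is contained in
no other interval than [p], so the count at that window is the multiplicity of
[p].  Hence [p] lies in both multisets and can be removed from both. *)
Lemma rank_invariant_inj s s' :
  {in s, forall p, p.1 < p.2} -> {in s', forall p, p.1 < p.2} ->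
  (forall X Y, X < Y -> count (contains X Y) s = count (contains X Y) s') ->
  perm_eq s s'.
Proof.
have [n] := ubnP (size (s ++ s')); elim: n => // n IH in s s' * => sz s_lt s'_lt E.
case ss': (s ++ s') => [|p0 u]; first by case: s ss' {sz s_lt E} => //= ->.
have [p pss' p_max] : exists2 p, p \in s ++ s' &
    {in s ++ s', forall q, q.2 - q.1 <= p.2 - p.1}.
  rewrite ss'; elim: u p0 {ss'} => [|q u IHu] p0.
    by exists p0; rewrite ?mem_head // => q; rewrite inE => /eqP->.
  have [p p_in p_max] := IHu q.
  have [pp0|p0p] := leP (p.2 - p.1) (p0.2 - p0.1).
    exists p0; rewrite ?mem_head // => r; rewrite inE => /orP[/eqP->//|/p_max].
    by move/le_trans; apply.
  exists p; first by rewrite inE p_in orbT.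
  by move=> r; rewrite inE => /orP[/eqP->|/p_max//]; exact: ltW.
have p_lt : p.1 < p.2.
  by move: pss'; rewrite mem_cat => /orP[/s_lt|/s'_lt].
have cnt v : {subset v <= s ++ s'} -> count (contains p.1 p.2) v = count_mem p v.
  move=> vs; apply: eq_in_count => q /vs /p_max qp.
  apply/andP/eqP => [[q1 q2]|->]; last by rewrite !lexx.
  by case: p q q1 q2 qp {pss' p_max p_lt} => [a b] [c d] /= *; congr pair; lra.
have cntE : count_mem p s = count_mem p s'.
  by rewrite -!cnt ?E // => q qs; rewrite mem_cat qs ?orbT.
have ps : p \in s.
  by move: pss'; rewrite mem_cat -!has_pred1 !has_count cntE orbb.
have ps' : p \in s' by move: ps; rewrite -!has_pred1 !has_count cntE.
have rs := perm_to_rem ps; have rs' := perm_to_rem ps'.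
rewrite (permPl rs) (perm_sym _ s') (permPl rs') perm_cons perm_sym.
apply: IH => [|q /mem_rem /s_lt|q /mem_rem /s'_lt|X Y XY] //.
- by move: sz; rewrite !size_cat (perm_size rs) (perm_size rs') /=; lia.
- have := E X Y XY; rewrite (permP rs) (permP rs') /=; exact: addnI.
Qed.

End Ranks.

(** * Slopes and peaks of a curve *)

Section Pieces.
Variable R : realType.
Implicit Types (f : R -> R).

(** The contribution of a single curve to the degree. *)
Definition peak_index f (t h : R) : int :=
  (`[< local_max f t h >] : nat)%:Z - (`[< local_min f t h >] : nat)%:Z.

(** The base of the tent with peak [(m, r)].  In these coordinates a piece of slope [1] fixes the first coordinate and a piece of slope
[-1] fixes the second one, so the graph of a landscape curve becomes a staircase
that is monotone in both coordinates. *)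
Definition bar (p : R * R) : R * R := (p.1 - p.2, p.1 + p.2).

(** Slopes are integers, so that they can be compared with degrees.  Slope [0] comes
with height [0], because a landscape curve is flat only outside its support. *)
Definition affine_piece f (x y : R) (a : int) :=
  [/\ x < y, forall m, x <= m <= y -> f m = f x + a%:~R * (m - x)
   & a = 1 \/ a = -1 \/ a = 0 /\ f x = 0].

Lemma near_itv (x m y : R) : x < m -> m < y -> \forall s \near m, x < s < y.
Proof.
move=> xm my; near=> s; apply/andP; split; near: s.
  exact: lt_nbhsr.
exact: lt_nbhsl.
Unshelve. all: by end_near. Qed.

Lemma derivable_two_sided f (x m y : R) (a b : R) : x < m -> m < y ->
  (forall s, x <= s <= m -> f s = f m + a * (s - m)) ->
  (forall s, m <= s <= y -> f s = f m + b * (s - m)) ->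
  derivable f m 1 <-> a = b.
Proof.
move=> xm my fl fr; split=> [/cvg_ex[l fm]|ab]; last first.
  have : is_derive m 1 (fun s => f m + a * (s - m)) a.
    apply: is_derive_eq; rewrite /GRing.scale /=; ring.
  move=> da; apply: (@near_eq_derivable _ _ _ (fun s => f m + a * (s - m))) => //.
  near=> s; have /andP[xs sy] : x < s < y by near: s; exact: near_itv.
  have [sm|ms] := leP s m; first by rewrite (fl s) ?(ltW xs).
  by rewrite ab (fr s) ?(ltW ms) ?(ltW sy).
have al : a = l.
  have := cvg_dnbhs_at_left fm; move/cvg_lim => <- //.
  apply/esym/lim_near_cst => //; near=> h.
  have h0 : h < 0 by near: h; exact: nbhs_left_lt.
  have hx : x - m < h by near: h; apply: nbhs_left_gt; rewrite subr_lt0.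
  rewrite /GRing.scale /= mulr1 fl; last by apply/andP; split; lra.
  by field; rewrite lt_eqF.
have bl : b = l.
  have := cvg_dnbhs_at_right fm; move/cvg_lim => <- //.
  apply/esym/lim_near_cst => //; near=> h.
  have h0 : 0 < h by near: h; exact: nbhs_right_gt.
  have hx : h < y - m by near: h; apply: nbhs_right_lt; rewrite subr_gt0.
  rewrite /GRing.scale /= mulr1 fr; last by apply/andP; split; lra.
  by field; rewrite gt_eqF.
by rewrite al bl.
Unshelve. all: by end_near. Qed.

Lemma affine_pieceR f x m a : affine_piece f x m a ->
  forall s, x <= s <= m -> f s = f m + a%:~R * (s - m).
Proof.
move=> [xm fE _] s xsm; rewrite (fE s) // (fE m) ?lexx ?ltW //; ring.
Qed.

(** At positive height both slopes are [1] or [-1]: equal slopes make the point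
regular, a drop from [1] to [-1] is a maximum and a rise from [-1] to [1] is a
minimum.  Thus the index is half the drop of slope, which telescopes. *)
Lemma peak_indexE f x m y a b : affine_piece f x m a -> affine_piece f m y b ->
  0 < f m -> peak_index f m (f m) *+ 2 = a - b.
Proof.
move=> fa fb fm0; have faR := affine_pieceR fa.
have [xm _ aE] := fa; have [my fbE bE] := fb.
(* One-sided difference quotients are constant, so being critical means a jump. *)
have crit : critical_point f m <-> a <> b.
  rewrite /critical_point (derivable_two_sided xm my faR fbE).
  by split=> ab ?; apply: ab; [subst | exact: (intr_inj (R := R))].
have {}aE : a = 1 \/ a = -1.
  case: aE => [->|[->|[a0 fx0]]]; [by left|by right|].
  have [_ /(_ m) fE _] := fa.
  by move: fm0; rewrite fE ?fx0 ?a0 ?mul0r ?addr0 ?ltxx // lexx (ltW xm).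
have {}bE : b = 1 \/ b = -1.
  by case: bE => [->|[->|[b0 f0]]]; [left|right|move: fm0; rewrite f0 ltxx].
have near_m (P : R -> Prop) : (forall s, x < s < y -> P s) ->
    (\forall s \near m, P s).
  by move=> H; apply: filterS (near_itv xm my) => s /H.
have not_near (P : R -> Prop) : (\forall s \near m, P s) ->
    (exists s, x < s < m /\ P s) /\ (exists s, m < s < y /\ P s).
  move=> mP; split.
    have : \forall s \near m^'-, x < s < m /\ P s.
      near=> s; split; last by near: s; exact: cvg_within.
      by apply/andP; split; near: s; [exact: nbhs_left_gt|exact: nbhs_left_lt].
    exact: filter_ex.
  have : \forall s \near m^'+, m < s < y /\ P s.
    near=> s; split; last by near: s; exact: cvg_within.
    by apply/andP; split; near: s; [exact: nbhs_right_gt|exact: nbhs_right_lt].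
  exact: filter_ex.
have fl s : x < s < m -> f s = f m + a%:~R * (s - m).
  by move=> /andP[? ?]; rewrite faR // !ltW.
have fr s : m < s < y -> f s = f m + b%:~R * (s - m).
  by move=> /andP[? ?]; rewrite fbE // !ltW.
have [ab|/eqP ab] := eqVneq a b.
  have ncrit : ~ critical_point f m by rewrite crit; apply.
  rewrite /peak_index !asboolF /=; first by rewrite ab !subrr.
    by case.
  by case.
have both (P : R -> Prop) : (forall s, x < s < m -> P s) -> P m ->
    (forall s, m < s < y -> P s) -> \forall s \near m, P s.
  move=> Pl Pm Pr; apply: near_m => s /andP[xs sy].
  by have [sm|ms|->//] := ltgtP s m; [apply: Pl; rewrite xs|apply: Pr; rewrite ms].
have [[a1 b1]|[a1 b1]] : (a = 1 /\ b = -1) \/ (a = -1 /\ b = 1).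
- by case: aE bE ab => -> [] -> // _; [left|right].
- rewrite /peak_index asboolT ?asboolF ?a1 ?b1 //.
    by move=> [_ _ /not_near[[s [xsm]]]]; rewrite (fl s xsm) a1; lra.
  split=> //; first exact/crit.
  by apply: both => // s ss; rewrite ?(fl s ss) ?(fr s ss) ?a1 ?b1; lra.
- rewrite /peak_index asboolF ?asboolT ?a1 ?b1 //.
    split=> //; first exact/crit.
    by apply: both => // s ss; rewrite ?(fl s ss) ?(fr s ss) ?a1 ?b1; lra.
  by move=> [_ _ /not_near[[s [xsm]]]]; rewrite (fl s xsm) a1; lra.
Unshelve. all: by end_near. Qed.

(** The list may contain points where the slope does not change; this allows one
list of breaks to serve several curves at once. *)
Definition affine_off f (L : seq R) := forall I : interval R,
  (forall c, c \in L -> c \notin I) ->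
  exists a b : R, forall t, t \in I -> f t = a * t + b.

Lemma eq_at_limit f g (x : R) (F : set_system R) {FF : ProperFilter F} :
  F --> x -> {for x, continuous f} -> {for x, continuous g} ->
  (\forall s \near F, f s = g s) -> f x = g x.
Proof.
move=> Fx fx gx fg.
have fF : f @ F --> f x by exact: (cvg_comp _ _ Fx fx).
have gF : g @ F --> g x by exact: (cvg_comp _ _ Fx gx).
apply: (cvg_unique _ fF) => //.
by apply: cvg_trans gF; apply: near_eq_cvg; apply: filterS fg => s ->.
Qed.

(** Where the curve is positive at the midpoint, that point is regular and in the
support, so the slope is [1] or [-1].  Where it vanishes there, nonnegativity on
both sides forces the affine function to be zero. *)
Lemma landscape_affine_piece f L x y : landscape_curve f -> affine_off f L ->
  x < y -> (forall c, c \in L -> ~~ (x < c < y)) ->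
  exists a, affine_piece f x y a.
Proof.
move=> fL fE xy Lxy.
have [|a [b fab]] := fE `]x, y[%R.
  by move=> c /Lxy; rewrite in_itv.
have {}fab t : x < t < y -> f t = a * t + b by move=> tI; apply: fab; rewrite in_itv.
have fc : continuous f by exact: landscape_curve_continuous.
have gc : continuous (fun t : R => a * t + b).
  by move=> t; apply: cvgD; [apply: cvgM; [exact: cvg_cst|exact: cvg_id]|exact: cvg_cst].
have fx : f x = a * x + b.
  apply: (@eq_at_limit f (fun t : R => a * t + b) x x^'+); [|exact: fc|exact: gc|].
    exact: cvg_within.
  near=> t; apply: fab; apply/andP; split; near: t.
    exact: nbhs_right_gt.
  exact: nbhs_right_lt.
have fy : f y = a * y + b.
  apply: (@eq_at_limit f (fun t : R => a * t + b) y y^'-); [|exact: fc|exact: gc|].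
    exact: cvg_within.
  near=> t; apply: fab; apply/andP; split; near: t.
    exact: nbhs_left_gt.
  exact: nbhs_left_lt.
(* By continuity the affine formula extends to the end points. *)
have {}fab t : x <= t <= y -> f t = f x + a * (t - x).
  rewrite fx !le_eqVlt => /andP[/orP[/eqP<-|xt] /orP[/eqP->|ty]].
  - by rewrite fy; ring.
  - by rewrite fx; ring.
  - by rewrite fy; ring.
  - by rewrite fab ?xt //; ring.
pose m := (x + y) / 2.
have [xm my] : x < m /\ m < y by rewrite /m; split; lra.
have [fm0|fm0] := eqVneq (f m) 0.
  have f0 := landscape_curve_ge0 fL.
  have a0 : a = 0.
    have := f0 x; have := f0 y; rewrite (fab y) ?(ltW xy) ?lexx //.
    move: fm0; rewrite fab ?(ltW xm) ?(ltW my) // /m => fm0 hy hx.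
    have a1 : a * (y - x) = 0 by nra.
    move/eqP: a1; rewrite mulf_eq0 subr_eq0 => /orP[/eqP->//|/eqP yx].
    by move: xy; rewrite yx ltxx.
  exists 0; split=> //; last first.
    right; right; split=> //; move: fm0.
    by rewrite fab ?(ltW xm) ?(ltW my) // a0 mul0r addr0.
  by move=> t /fab ->; rewrite a0.
have fd : is_derive m 1 f a.
  apply: (@near_eq_is_derive _ _ _ (fun t : R => f x + a * (t - x))).
    by near=> t; rewrite (fab t) //; near: t; apply: filterS (near_itv xm my) => t
      /andP[? ?]; apply/andP; split; exact: ltW.
  by apply: is_derive_eq; rewrite /GRing.scale /=; ring.
have := landscape_curve_slope fL (t := m).
have -> : derive1 f m = a by rewrite derive1E; exact: derive_val.
move=> sl.
have [||a1|a1] := sl.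
- exact: subset_closure.
- by move=> ncrit; apply: ncrit; case: fd.
- by exists 1; split=> //; [move=> t /fab ->; rewrite a1|left].
- by exists (-1); split=> //; [move=> t /fab ->; rewrite a1 mulrN1z|right; left].
Unshelve. all: by end_near. Qed.

End Pieces.

(** * The signed number of peaks in a quadrant *)

Section Quadrant.
Variable R : realType.
Implicit Types (f : R -> R) (L B : seq R) (m x y s t : R).

Fixpoint affine_path f x L : Prop :=
  if L is y :: L' then (exists a, affine_piece f x y a) /\ affine_path f y L'
  else True.

Lemma landscape_affine_path f B x L : landscape_curve f -> affine_off f B ->
  path <%R x L -> {in B, forall c, x < c < last x L -> c \in L} ->
  affine_path f x L.
Proof.
move=> fL fB; elim: L x => //= y L IH x /andP[xy yL] BL.
have yLall : all (> y) L by apply: order_path_min yL => a b c; exact: lt_trans.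
have y_last : y <= last y L.
  have := mem_last y L; rewrite inE => /orP[/eqP->//|].
  by move/(allP yLall); exact: ltW.
split.
  apply: (landscape_affine_piece fL fB xy) => c cB; apply/negP => /andP[xc cy].
  have := BL c cB; rewrite xc (lt_le_trans cy) // inE lt_eqF //= => /(_ isT).
  by move/(allP yLall) => /=; rewrite ltNge (ltW cy).
apply: IH => // c cB /andP[yc cl].
have := BL c cB; rewrite (lt_trans xy yc) cl inE gt_eqF //=; exact.
Qed.

Lemma affine_piece_lipschitz f x y a s t : affine_piece f x y a ->
  x <= s -> s <= t -> t <= y -> `|f t - f s| <= t - s.
Proof.
move=> [_ fE aE] xs st ty; rewrite (fE s) ?(fE t) ?xs ?ty ?(le_trans st) ?(le_trans xs) //.
rewrite (_ : _ - _ = a%:~R * (t - s)); last by ring.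
rewrite normrM (ger0_norm (x := t - s)) ?subr_ge0 // ler_piMl ?subr_ge0 //.
by case: aE => [->|[->|[->]]]; rewrite ?normrN ?normr1 ?normr0.
Qed.

Lemma affine_path_lipschitz f x L s t : affine_path f x L ->
  x <= s -> s <= t -> t <= last x L -> `|f t - f s| <= t - s.
Proof.
elim: L x s => [|y L IH] x s /=.
  move=> _ xs st tx; have -> : s = t by apply/eqP; rewrite eq_le st (le_trans tx).
  by rewrite !subrr normr0.
move=> [[a fa] fL] xs st tl; have [ty|yt] := leP t y.
  exact: affine_piece_lipschitz fa xs st ty.
have [ys|sy] := leP y s; first exact: IH ys st tl.
have H1 := IH _ _ fL (lexx y) (ltW yt) tl.
have H2 := affine_piece_lipschitz fa xs (ltW sy) (lexx y).
have -> : f t - f s = (f t - f y) + (f y - f s) by ring.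
by apply: le_trans (ler_normD _ _) _; lra.
Qed.

(** The breaks between [s] and [t] divide the graph into pieces of slope at most [1]. *)
Lemma landscape_lipschitz f B s t : landscape_curve f -> affine_off f B ->
  s <= t -> `|f t - f s| <= t - s.
Proof.
rewrite le_eqVlt => fL fB /orP[/eqP->|st]; first by rewrite !subrr normr0.
pose L := rcons (sort <=%R (undup [seq c <- B | s < c < t])) t.
have inL c : (c \in sort <=%R (undup [seq c <- B | s < c < t])) = (s < c < t) && (c \in B).
  by rewrite mem_sort mem_undup mem_filter.
apply: (@affine_path_lipschitz f s L); rewrite ?last_rcons ?(ltW st) //.
apply: landscape_affine_path fL fB _ _; last first.
  by move=> c cB; rewrite last_rcons mem_rcons inE inL cB andbT => ->; rewrite orbT.
rewrite rcons_path; apply/andP; split.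
  rewrite lt_path_sortedE sort_lt_sorted undup_uniq andbT.
  by apply/allP => c; rewrite inL => /andP[/andP[]].
have := mem_last s (sort <=%R (undup [seq c <- B | s < c < t])).
by rewrite inE inL => /orP[/eqP->//|/andP[/andP[]]].
Qed.

Section Window.
Variables (f : R -> R) (X Y : R).
Hypotheses (XY : X < Y) (f_lip : forall s t, s <= t -> `|f t - f s| <= t - s).

Let left_of (m : R) := m - f m <= X.
Let right_of (m : R) := Y <= m + f m.
Let inside (m : R) := contains X Y (bar (m, f m)).
Let mid := (X + Y) / 2.

(** Twice the signed number of peaks of the graph that lie in the quadrant of the
window and strictly to the right of [x], for a curve that vanishes far to the right
and has slope [a] just after [x].  If the graph meets the quadrant ([inside mid]),
this number is [2] before the quadrant is entered ([left_of] only), [1 + a] while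
inside ([left_of] and [right_of]), and [0] once it is left ([right_of] only). *)
Definition potential (x : R) (a : int) : int :=
  (inside x)%:Z * a + (inside mid)%:Z * (1 - (right_of x)%:Z + (left_of x)%:Z).

Let insideE m : inside m = left_of m && right_of m.
Proof. by []. Qed.

Let left_mono x y : x <= y -> left_of y -> left_of x.
Proof. by rewrite /left_of => /f_lip; rewrite ler_norml => /andP[]; lra. Qed.

Let right_mono x y : x <= y -> right_of x -> right_of y.
Proof. by rewrite /right_of => /f_lip; rewrite ler_norml => /andP[]; lra. Qed.

(** A 1-Lipschitz graph meeting the quadrant passes above its corner. *)
Let inside_mid m : inside m -> inside mid.
Proof.
rewrite !insideE /left_of /right_of => /andP[ml mr].
have [/f_lip|/ltW /f_lip] := leP m mid; rewrite ler_norml => /andP[];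
  rewrite /mid => *; apply/andP; split; lra.
Qed.

Let mid_side m : inside mid -> left_of m || right_of m.
Proof.
rewrite insideE => /andP[ml mr].
by have [/left_mono->//|/ltW /right_mono->] := leP m mid; rewrite ?orbT.
Qed.

(** No peak lies in the interior of an affine piece, so the potential is constant
along it.  Slope [1] preserves [left_of] and slope [-1] preserves [right_of]; on a
flat piece the curve is zero, and if that piece crossed the whole window, the
curve would vanish at [mid]. *)
Lemma potential_piece x y a : affine_piece f x y a ->
  potential x a = potential y a.
Proof.
move=> [xy fE aE]; have fy : f y = f x + a%:~R * (y - x) by rewrite fE // lexx ltW.
have /implyP := @left_mono x y (ltW xy).
have /implyP := @right_mono x y (ltW xy).
have /implyP := @inside_mid x; have /implyP := @inside_mid y.
have /implyP := @mid_side x; have /implyP := @mid_side y.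
rewrite /potential !(insideE x) !(insideE y).
case: aE => [a1|[a1|[a0 fx0]]].
- have -> : left_of y = left_of x.
    by rewrite /left_of fy a1; congr (_ <= _); ring.
  rewrite a1; case: (left_of x); case: (right_of x); case: (right_of y);
  by case: (inside mid) => //= *; lia.
- have -> : right_of y = right_of x.
    by rewrite /right_of fy a1; congr (_ <= _); ring.
  rewrite a1; case: (left_of x); case: (right_of x); case: (left_of y);
  by case: (inside mid) => //= *; lia.
rewrite a0 mul0r addr0 in fy.
have xNin : ~~ (left_of x && right_of x).
  by apply/negP => /andP[]; rewrite /left_of /right_of fx0 subr0 addr0; move: XY; lra.
have yNin : ~~ (left_of y && right_of y).
  by apply/negP => /andP[]; rewrite /left_of /right_of fy fx0 subr0 addr0; move: XY; lra.
have mid_out : ~~ [&& inside mid, left_of x & right_of y].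
  apply/negP => /and3P[]; rewrite insideE /left_of /right_of fy fx0 subr0 addr0.
  move=> /andP[ml _] xX Yy; move: ml XY.
  rewrite (fE mid); first by rewrite a0 mul0r fx0 addr0 subr0 /mid; lra.
  by rewrite /mid; move: XY => ?; apply/andP; split; lra.
move: xNin yNin mid_out.
rewrite a0; case: (left_of x); case: (right_of x); case: (left_of y);
  by case: (right_of y); case: (inside mid) => //= *; lia.
Qed.

(** At a break inside the quadrant the potential drops by the drop of slope, which
is twice the index; at a break outside it does not change. *)
Lemma index_sum_path x y L a :
  affine_piece f x y a -> affine_path f y L -> f (last y L) = 0 ->
  (forall m, 0 <= f m) ->
  (\sum_(m <- y :: L) (inside m)%:Z * peak_index f m (f m)) *+ 2 =
  potential x a - potential (last y L) 0.
Proof.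
move=> fa fL fl f0.
have inside0 m : f m = 0 -> inside m = false.
  move=> fm0; apply/negP; rewrite insideE /left_of /right_of fm0 subr0 addr0.
  by move=> /andP[]; move: XY; lra.
elim: L x y a => [|z L IH] x y a /= in fa fL fl *.
  rewrite big_seq1 (potential_piece fa) /potential (inside0 _ fl) !mul0r mul0rn.
  by rewrite subrr.
have [[b fb] {}fL] := fL.
rewrite big_cons mulrnDl (IH y z b fb fL fl) (potential_piece fa) -mulrnAr.
have [/eqP fy0|fy0] := boolP (f y == 0).
  by rewrite /potential (inside0 _ fy0) !mul0r add0r.
rewrite (peak_indexE fa fb) ?lt0r ?fy0 ?f0 // /potential; ring.
Qed.

End Window.

(** Sweeping from a point far to the left, where the potential is twice the right
hand side, to a point far to the right, where it is [0], gives the signed count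
of peaks in the quadrant: the staircase alternates between maxima and minima
inside the quadrant, with a maximum first and a maximum last. *)
Lemma peak_index_sum f B X Y : landscape_curve f -> affine_off f B -> uniq B ->
  X < Y ->
  \sum_(m <- B) (contains X Y (bar (m, f m)))%:Z * peak_index f m (f m) =
  (contains X Y (bar ((X + Y) / 2, f ((X + Y) / 2))))%:Z.
Proof.
move=> fL fB uB XY.
have f0 := landscape_curve_ge0 fL.
have f_lip s t : s <= t -> `|f t - f s| <= t - s by exact: landscape_lipschitz fL fB.
(* [A] bounds the support, the breaks and the window. *)
have [A [A_f A_B XA YA]] : exists A, [/\ forall m, A <= `|m| -> f m = 0,
    {in B, forall c, `|c| < A}, - A < X & Y < A].
  have [M [_ HM]] := compact_bounded (landscape_curve_compact fL).
  have [M' HM'] : exists M', {in B, forall c, `|c| < M'}.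
    elim: B {fB uB} => [|c B [M' HM']]; first by exists 0.
    exists (Num.max M' (`|c| + 1)) => d; rewrite inE lt_max => /orP[/eqP->|/HM' ->//].
    by rewrite ltrDl ltr01 orbT.
  exists (`|M| + 2 + `|M'| + `|X| + `|Y|).
  have := ler_norm M; have := ler_norm M'; have := ler_norm X; have := ler_norm Y.
  have := ler_norm (- X); rewrite normrN.
  have := normr_ge0 M; have := normr_ge0 M'; have := normr_ge0 X; have := normr_ge0 Y.
  move=> *; split; [|by move=> c /HM' *; lra|lra|lra].
  move=> m mA; apply/eqP/negPn/negP => fm.
  have := HM (`|M| + 1); rewrite /= => /(_ _ m).
  have := @subset_closure _ [set t | f t != 0] m fm => msup /(_ _ msup); lra.
have B_in c : c \in B -> - A < c < A by move/A_B; rewrite ltr_norml.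
pose L := rcons (sort <=%R B) A.
have LA : last (- A) L = A by rewrite last_rcons.
have AA : - A < A by lra.
have fpath : affine_path f (- A) L.
  apply: landscape_affine_path fL fB _ _; last first.
    by move=> c cB _; rewrite mem_rcons inE mem_sort cB orbT.
  rewrite rcons_path; apply/andP; split.
    rewrite lt_path_sortedE sort_lt_sorted uB andbT.
    by apply/allP => c; rewrite mem_sort => /B_in /andP[].
  have := mem_last (- A) (sort <=%R B).
  by rewrite inE mem_sort => /orP[/eqP->//|/B_in /andP[]].
have fA : f A = 0 by apply: A_f; exact: ler_norm.
have fNA : f (- A) = 0 by apply: A_f; rewrite normrN; exact: ler_norm.
have XA' : (A <= X) = false by rewrite leNgt (lt_trans XY).
have YNA : (Y <= - A) = false by rewrite leNgt (lt_trans XA).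
have <- : \sum_(m <- L) (contains X Y (bar (m, f m)))%:Z * peak_index f m (f m) =
    \sum_(m <- B) (contains X Y (bar (m, f m)))%:Z * peak_index f m (f m).
  rewrite /L -cats1 big_cat big_seq1 /= fA /contains /= subr0 XA' mul0r addr0.
  by apply: perm_big; rewrite perm_sort.
case LE : L fpath LA => [|y L'] /= [].
  by move/(congr1 size): LE; rewrite size_rcons.
move=> [a fa] fL' LA; have := index_sum_path XY f_lip fa fL' _ f0.
rewrite LA => /(_ fA).
rewrite /potential /contains /= fA fNA !subr0 !addr0 XA' YNA (ltW XA) (ltW YA) /=.
rewrite mul0r add0r mulr0 add0r => sumE.
by apply/eqP; rewrite -(eqr_pMn2r (n := 2)) // sumE; apply/eqP; lia.
Qed.

End Quadrant.

(** * Degrees of a landscape sequence *)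

Section Degree.
Variable R : realType.
Implicit Types (lam : nat -> R -> R).

Lemma card_fset_set_asbool (A : set nat) (K : nat) : A `<=` `I_K ->
  #|` fset_set A| = (\sum_(0 <= k < K) `[< A k >])%N.
Proof.
move=> AK; have finA : finite_set A by exact: sub_finite_set AK (finite_II K).
have -> : (\sum_(0 <= k < K) `[< A k >])%N = count (fun k => `[< A k >]) (iota 0 K).
  by rewrite -sum1_count /index_iota subn0 [RHS]big_mkcond; apply: eq_bigr => k _; case: asbool.
rewrite -size_filter; apply: perm_size; apply: uniq_perm.
- exact: fset_uniq.
- exact/filter_uniq/iota_uniq.
move=> k; rewrite in_fset_set // mem_filter mem_iota add0n /=.
by apply/idP/idP => [|/andP[/asboolP Ak _]]; rewrite inE // => Ak;
  rewrite asboolT //=; exact: AK.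
Qed.

(** Zero curves have no critical point, so the cardinals defining the degree are
finite sums over the first [K] curves. *)
Lemma deg_sum lam K t h : (forall k, (K <= k)%N -> forall t, lam k t = 0) ->
  deg lam t h = \sum_(0 <= k < K) peak_index (lam k) t h.
Proof.
move=> lam0.
have crit k : critical_point (lam k) t -> (k < K)%N.
  move=> kt; rewrite ltnNge; apply/negP => /lam0 lamk; apply: kt.
  have -> : lam k = cst 0 by apply/funext.
  exact: derivable_cst.
rewrite /deg !(@card_fset_set_asbool _ K) => [|k [_ /crit]|k [_ /crit]] //.
rewrite /peak_index sumrB -!natz !natr_sum.
by congr (_ - _); apply: eq_bigr => k _; rewrite natz.
Qed.

Lemma bar_inj : injective (@bar R).
Proof. by move=> [m r] [m' r'] [e1 e2]; congr pair; lra. Qed.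

Lemma peak_index_neq0 (f : R -> R) t h : peak_index f t h != 0 -> f t = h.
Proof.
rewrite /peak_index; case: asboolP => [[] //|_]; case: asboolP => [[] //|_].
by rewrite subrr eqxx.
Qed.

Lemma landscape_common_breaks lam K : landscape_sequence lam ->
  exists2 B : seq R, uniq B & forall k, (k < K)%N -> affine_off (lam k) B.
Proof.
move=> lamL.
have /choice[br brP] : forall k, exists B, affine_off (lam k) B.
  by move=> k; exact: landscape_curve_pl (landscape_sequence_curve lamL k).
exists (undup (flatten [seq br k | k <- iota 0 K])); first exact: undup_uniq.
move=> k kK I BI; apply: brP => c cbr; apply: BI.
rewrite mem_undup; apply/flattenP; exists (br k) => //.
by apply: map_f; rewrite mem_iota.
Qed.

(** Duplicates are removed because the degree of a point that lies on several curves
already counts all of them. *)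
Definition graph_points lam (B : seq R) (K : nat) : seq (R * R) :=
  undup [seq (m, lam k m) | k <- iota 0 K, m <- B].

(** Exchanging the sums over points and over curves reduces this to the signed count
for one curve: a point off the graph of the [k]-th curve has index [0] for it. *)
Lemma deg_sum_contains lam K (B : seq R) X Y : landscape_sequence lam ->
  (forall k, (K <= k)%N -> forall t, lam k t = 0) ->
  uniq B -> (forall k, (k < K)%N -> affine_off (lam k) B) -> X < Y ->
  \sum_(p <- graph_points lam B K | contains X Y (bar p)) deg lam p.1 p.2 =
  (\sum_(0 <= k < K) contains X Y (bar ((X + Y) / 2, lam k ((X + Y) / 2))))%N%:Z.
Proof.
move=> lamL lam0 uB affB XY; set P := graph_points lam B K.
rewrite -natz natr_sum.
under [LHS]eq_bigr do rewrite (deg_sum _ _ lam0).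
rewrite exchange_big /=; apply: eq_big_nat => k /andP[_ kK].
rewrite natz -(peak_index_sum (landscape_sequence_curve lamL k) (affB k kK) uB XY).
pose Pk := [seq (m, lam k m) | m <- B].
have uPk : uniq Pk by rewrite map_inj_uniq // => m n [].
have PkP : perm_eq [seq p <- P | p \in Pk] Pk.
  apply: uniq_perm => // [|p]; first exact/filter_uniq/undup_uniq.
  rewrite mem_filter andb_idr // => /mapP[m mB ->].
  by rewrite mem_undup; apply: allpairs_f => //; rewrite mem_iota.
rewrite -(big_map (fun m => (m, lam k m)) xpredT
  (fun p => (contains X Y (bar p))%:Z * peak_index (lam k) p.1 p.2)) -/Pk.
rewrite -(perm_big _ PkP) big_filter big_mkcond [RHS]big_mkcond /=.
apply: eq_big_seq => -[m h].
rewrite mem_undup => /allpairsP[[j n] /= [_ nB [-> hE]]] {m}.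
have [|] := boolP ((n, h) \in Pk); first by case: contains => _; rewrite ?mul1r ?mul0r.
move=> nPk; case: contains => //; apply/eqP; apply: contraNT nPk.
by move/peak_index_neq0 => <-; apply: map_f.
Qed.

(** A finite initial segment of the integers is determined by its cardinal. *)
Lemma ltn_sum_initial (g : pred nat) (K k : nat) :
  (forall j, g j.+1 -> g j) -> (forall j, g j -> (j < K)%N) ->
  (k < \sum_(0 <= j < K) g j)%N = g k.
Proof.
move=> g_down gK.
have g_le i j : (i <= j)%N -> g j -> g i.
  by move=> /subnK <-; elim: (j - i)%N => // n IH /g_down.
suff -> : (k < \sum_(0 <= j < K) g j)%N = g k && (k < K)%N.
  by case gk: (g k) => //=; exact: gK.
elim: K {gK} => [|K IH]; first by rewrite big_nil andbF.
rewrite big_nat_recr //=; case gKE: (g K); last first.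
  rewrite addn0 IH ltnS; case: (ltngtP k K) => [kK|kK|->]; rewrite ?andbF ?gKE //.
have -> : (\sum_(0 <= j < K) g j)%N = K.
  rewrite -[RHS]muln1 -[in RHS](subn0 K) -sum_nat_const_nat.
  by apply: eq_big_nat => j /andP[_ jK]; rewrite (g_le j K) // ltnW.
by rewrite addn1 andb_idl // ltnS => kK; exact: g_le kK gKE.
Qed.

End Degree.

(** * The decomposition theorem *)

Theorem theorem3p17 (R : realType) (lam : nat -> R -> R)
    (hlam : landscape_sequence lam) :
  exists s : seq (R * R),
    [/\ tent_decomposition lam s,
        forall b d : R, (b, d) \in s ->
          (count_mem (b, d) s)%:Z = deg lam ((b + d) / 2) ((d - b) / 2) /\
          0 < deg lam ((b + d) / 2) ((d - b) / 2)
      & forall s' : seq (R * R), tent_decomposition lam s' -> perm_eq s s'].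
Proof.
have [K lam0] := landscape_sequence_finite hlam.
have [B uB affB] := landscape_common_breaks K hlam.
pose P := [seq p <- graph_points lam B K | 0 < p.2].
pose s := flatten [seq nseq `|deg lam p.1 p.2|%N (bar p) | p <- P].
have uP : uniq P by exact/filter_uniq/undup_uniq.
have deg_abs p : p \in P -> (`|deg lam p.1 p.2|%N)%:Z = deg lam p.1 p.2.
  rewrite mem_filter => /andP[p0 _].
  by rewrite gez0_abs // (landscape_sequence_deg hlam).
have countE (a : pred (R * R)) :
    (count a s)%:Z = \sum_(p <- P | a (bar p)) deg lam p.1 p.2.
  rewrite /s count_flatten -map_comp sumnE big_map -natz natr_sum [RHS]big_mkcond.
  apply: eq_big_seq => p pP /=; rewrite count_nseq natz PoszM deg_abs //.
  by case: (a _); rewrite ?mul1r ?mul0r.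
have s_lt : {in s, forall p, p.1 < p.2}.
  move=> p /flattenP[_ /mapP[q qP ->]] /nseqP[-> _] /=.
  by move: qP; rewrite mem_filter => /andP[q0 _]; lra.
(* The window of the point [(t, h)] has midpoint [t] and half-length [h]. *)
have s_rank : has_rank lam (fun t h => count (contains (t - h) (t + h)) s).
  move=> k t; split=> [|h h0].
    exact: landscape_curve_ge0 (landscape_sequence_curve hlam k) t.
  have tE : (t - h + (t + h)) / 2 = t by field.
  rewrite -(@ltn_sum_initial (fun j => h <= lam j t) K); first last.
  - by move=> j hj; rewrite ltnNge; apply/negP => /lam0 lamj; move: hj; rewrite lamj lt_geF.
  - by move=> j /le_trans; apply; exact: landscape_sequence_decr.
  congr (_ < _)%N; apply/eqP; rewrite -eqz_nat countE big_filter_cond; apply/eqP.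
  have XY : t - h < t + h by lra.
  have := deg_sum_contains hlam lam0 uB affB XY.
  rewrite tE => /esym; under eq_bigr => j _.
    rewrite (_ : contains _ _ _ = (h <= lam j t)); first over.
    by rewrite /contains /=; apply/andP/idP => [[]|]; [|split]; lra.
  move=> ->; apply: eq_bigl => p /=; rewrite andb_idl // => /andP[] /=; lra.
exists s; split=> //.
- by split=> //; exact: has_rank_eq s_rank (has_rank_tents s).
- move=> b d bds.
  have [p pP /nseqP[bdE deg0]] : exists2 p, p \in P &
      (b, d) \in nseq `|deg lam p.1 p.2|%N (bar p).
    by have /flattenP[_ /mapP[p pP ->] ?] := bds; exists p.
  have pE : p = ((b + d) / 2, (d - b) / 2).
    by case: p bdE {pP deg0} => m r [-> ->]; congr pair => /=; field.
  have degE : (count_mem (b, d) s)%:Z = deg lam ((b + d) / 2) ((d - b) / 2).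
    rewrite countE big_mkcond (bigD1_seq p) //= bdE eqxx big1 ?addr0 ?pE //.
    by move=> q qp; rewrite (inj_eq (@bar_inj R)) (negPf qp).
  split=> //; rewrite -degE ltz_nat -has_count has_pred1 //.
- move=> s' [s'_lt lamE]; apply: rank_invariant_inj s_lt s'_lt _ => X Y XY.
  have lam_rank' : has_rank lam (fun t h => count (contains (t - h) (t + h)) s').
    by rewrite lamE; exact: has_rank_tents.
  have h0 : 0 < (Y - X) / 2 by lra.
  have := has_rank_uniq ((X + Y) / 2) s_rank lam_rank' h0.
  have -> : (X + Y) / 2 - (Y - X) / 2 = X by field.
  by have -> : (X + Y) / 2 + (Y - X) / 2 = Y by field.
Qed.
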